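(* Let $\mathcal W$ be the space of two-sided one-dimensional quantum walks whose coin sequence $(Q_n)_{n\in\mathbb Z}$ is limit-periodic with each $Q_n$ of the form $\Theta(\alpha_n,\lambda_n)$ and with $(Q_n)_{11}\ne0\ne(Q_n)_{22}$ for all $n$; equip $\mathcal W$ with the metric $\sup_n\|Q_n-Q_n'\|$. Then for a Baire-generic walk in $\mathcal W$ (i.e., for all walks in a set containing a dense $G_\delta$ subset of $\mathcal W$), the wavefunction of the particle escapes any bounded region in a time-averaged sense: denoting the update rule of the walk by $U$, for every initial state $\psi\in\ell^2(\mathbb Z)\otimes\mathbb C^2$ and every $J\in\mathbb Z_+$, $$\lim_{N\to\infty}\frac1{2N+1}\sum_{n=-N}^{N}\ \sum_{j=-J}^{J}\big|\langle\varphi_j,U^n\psi\rangle\big|^2=0 .$$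
   Context: Let $\mathbb D=\{z\in\mathbb C:|z|<1\}$. For $\alpha\in\mathbb D$ and $\lambda\in\partial\mathbb D$ put $$\Theta(\alpha,\lambda)=\lambda\begin{bmatrix}\overline\alpha&\rho\\ \rho&-\alpha\end{bmatrix}\in\mathbb U(2),\qquad \rho=\sqrt{1-|\alpha|^2}.$$ The state space is $\mathcal H=\ell^2(\mathbb Z)\otimes\mathbb C^2$ with orthonormal basis $\delta_n^{\pm}=\delta_n\otimes e_\pm$, where $e_+=(1,0)^\top$, $e_-=(0,1)^\top$. A (time-homogeneous) quantum walk on $\mathbb Z$ is specified by coins $Q_n=\begin{bmatrix}q_n^{11}&q_n^{12}\\ q_n^{21}&q_n^{22}\end{bmatrix}\in\mathbb U(2)$, $n\in\mathbb Z$. Its update rule is the unitary operator $U=SC$ on $\mathcal H$, where $S\delta_n^\pm=\delta_{n\pm1}^\pm$ and $C\delta_n^+=q_n^{11}\delta_n^++q_n^{21}\delta_n^-$, $C\delta_n^-=q_n^{12}\delta_n^++q_n^{22}\delta_n^-$. The basis is ordered as $\varphi_{2m}=\delta_m^+$, $\varphi_{2m+1}=\delta_m^-$, $m\in\mathbb Z$. A sequence indexed by $\mathbb Z$ is limit-periodic if it is a uniform limit of periodic sequences. *)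

(* Defs.v *)
From HB Require Import structures.
From mathcomp Require Import all_boot all_order all_algebra.
From mathcomp Require Import all_classical all_reals all_analysis.
From mathcomp Require Import borel_hierarchy complex.
From mathcomp Require Import zify ring lra.

Set Implicit Arguments.
Unset Strict Implicit.
Unset Printing Implicit Defensive.

Import Order.TTheory GRing.Theory Num.Theory numFieldNormedType.Exports.
Import Normc.

Local Open Scope classical_set_scope.
Local Open Scope ring_scope.

Section Norms.
Variable R : realType.
Local Notation C := R[i].
Implicit Types (u v : 'cV[C]_2) (A B : 'M[C]_2).

Definition vnorm (v : 'cV[C]_2) : R :=
  Num.sqrt (\sum_(i < 2) normc (v i 0) ^+ 2).

Definition opnorm (A : 'M[C]_2) : R :=
  sup [set vnorm (A *m v) | v in [set v | vnorm v <= 1]].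

Lemma normc_ge0 (z : C) : 0 <= normc z.
Proof. by case: z => a b; exact: sqrtr_ge0. Qed.

Lemma normc_sq (z : C) : normc z ^+ 2 = complex.Re z ^+ 2 + complex.Im z ^+ 2.
Proof. by case: z => a b /=; rewrite sqr_sqrtr// addr_ge0// sqr_ge0. Qed.

Lemma normcJ' (z : C) : normc (z^*)%C = normc z.
Proof. by case: z => a b /=; rewrite sqrrN. Qed.

Lemma vnorm_ge0 v : 0 <= vnorm v. Proof. exact: sqrtr_ge0. Qed.

Lemma vnorm0 : vnorm 0 = 0.
Proof. by rewrite /vnorm big1 ?sqrtr0// => i _; rewrite mxE normc0 expr0n. Qed.

Lemma vnorm_sq v : vnorm v ^+ 2 = normc (v 0 0) ^+ 2 + normc (v 1 0) ^+ 2.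
Proof.
rewrite /vnorm sqr_sqrtr; last by apply: sumr_ge0 => i _; exact: sqr_ge0.
by rewrite !big_ord_recl big_ord0 addr0; congr (normc (v _ 0) ^+ 2 + normc (v _ 0) ^+ 2);
  apply/val_inj.
Qed.

Lemma ord2P (i : 'I_2) : i = 0 \/ i = 1.
Proof. by case: i => -[|[|//]] i; [left|right]; apply/val_inj. Qed.

Lemma normc_le_vnorm v i : normc (v i 0) <= vnorm v.
Proof.
rewrite -(@ler_pXn2r _ 2)// ?nnegrE ?normc_ge0 ?vnorm_ge0// vnorm_sq.
by case: (ord2P i) => ->; rewrite ?lerDl ?lerDr sqr_ge0.
Qed.

Lemma vnorm_le_sum v : vnorm v <= normc (v 0 0) + normc (v 1 0).
Proof.
rewrite -(@ler_pXn2r _ 2)// ?nnegrE ?addr_ge0 ?normc_ge0 ?vnorm_ge0//.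
rewrite vnorm_sq; have := normc_ge0 (v 0 0); have := normc_ge0 (v 1 0); nra.
Qed.

Lemma vnormD u v : vnorm (u + v) <= vnorm u + vnorm v.
Proof.
rewrite -(@ler_pXn2r _ 2)// ?nnegrE ?addr_ge0 ?vnorm_ge0//.
rewrite vnorm_sq !mxE.
have u2 := vnorm_sq u; have v2 := vnorm_sq v.
have := vnorm_ge0 u; have := vnorm_ge0 v.
have h0 := le_normcD (u 0 0) (v 0 0); have h1 := le_normcD (u 1 0) (v 1 0).
move: h0 h1 u2 v2.
have := normc_ge0 (u 0 0 + v 0 0); have := normc_ge0 (u 1 0 + v 1 0).
have := normc_ge0 (u 0 0); have := normc_ge0 (u 1 0).
have := normc_ge0 (v 0 0); have := normc_ge0 (v 1 0).
move: (normc (u 0 0 + v 0 0)) (normc (u 1 0 + v 1 0)) => s t.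
move: (normc (u 0 0)) (normc (u 1 0)) (normc (v 0 0)) (normc (v 1 0))
  (vnorm u) (vnorm v) => a b c d x y d0 c0 b0 a0 t0 s0 hs ht hx hy y0 x0.
have cs : a * c + b * d <= x * y.
  rewrite -(@ler_pXn2r _ 2)// ?nnegrE ?addr_ge0 ?mulr_ge0//.
  rewrite [leRHS]exprMn hx hy.
  have := sqr_ge0 (a * d - b * c); nra.
have : s ^+ 2 <= (a + c) ^+ 2 by rewrite ler_pXn2r// ?nnegrE// addr_ge0.
have : t ^+ 2 <= (b + d) ^+ 2 by rewrite ler_pXn2r// ?nnegrE// addr_ge0.
nra.
Qed.

Lemma vnormN v : vnorm (- v) = vnorm v.
Proof. by congr Num.sqrt; apply: eq_bigr => i _; rewrite mxE normcN. Qed.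

Let opset (A : 'M[C]_2) := [set vnorm (A *m v) | v in [set v | vnorm v <= 1]].

Lemma mulmx_entry_le A (v : 'cV[C]_2) i : vnorm v <= 1 ->
  normc ((A *m v) i 0) <= normc (A i 0) + normc (A i 1).
Proof.
move=> v1; rewrite mxE !big_ord_recl big_ord0 addr0.
have -> : lift ord0 ord0 = 1 :> 'I_2 by apply/val_inj.
apply: (le_trans (le_normcD _ _)); rewrite !normcM.
by apply: lerD; rewrite ler_piMr ?normc_ge0//;
  apply: (le_trans (normc_le_vnorm _ _) v1).
Qed.

Let opset_ub A :
  ubound (opset A)
    (normc (A 0 0) + normc (A 0 1) + (normc (A 1 0) + normc (A 1 1))).
Proof.
move=> _ [v /= v1 <-]; apply: (le_trans (vnorm_le_sum _)).
by apply: lerD; exact: mulmx_entry_le.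
Qed.

Let opset0 A : opset A 0.
Proof. by exists 0; rewrite /= ?mulmx0 vnorm0. Qed.

Let opset_has_sup A : has_sup (opset A).
Proof. by split; [exists 0; exact: opset0|eexists; exact: opset_ub]. Qed.

Lemma opnorm_ub A v : vnorm v <= 1 -> vnorm (A *m v) <= opnorm A.
Proof. by move=> v1; apply: ub_le_sup; [case: (opset_has_sup A)|exists v]. Qed.

Lemma opnorm_ge0 A : 0 <= opnorm A.
Proof. by apply: ub_le_sup; [case: (opset_has_sup A)|exact: opset0]. Qed.

Lemma opnorm_le_entries A : opnorm A <=
  normc (A 0 0) + normc (A 0 1) + (normc (A 1 0) + normc (A 1 1)).
Proof. by apply: ge_sup; [exists 0; exact: opset0|exact: opset_ub]. Qed.

Lemma entry_le_opnorm A i j : normc (A i j) <= opnorm A.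
Proof.
have e1 : vnorm (delta_mx j 0) <= 1.
  rewrite -(@ler_pXn2r _ 2)// ?nnegrE ?vnorm_ge0// vnorm_sq !mxE !eqxx !andbT.
  by case: (ord2P j) => ->; rewrite /= !expr0n/= !expr1n !addr0 sqrtr0 sqrtr1
    expr0n/= expr1n ?addr0 ?add0r.
have := opnorm_ub A e1; rewrite -colE; apply: le_trans.
by have := normc_le_vnorm (col j A) i; rewrite mxE.
Qed.

Lemma opnorm0 : opnorm 0 = 0.
Proof.
apply/eqP; rewrite eq_le opnorm_ge0 andbT.
by apply: (le_trans (opnorm_le_entries _)); rewrite !mxE normc0 !addr0.
Qed.

Lemma opnorm_eq0 A : opnorm A = 0 -> A = 0.
Proof.
move=> A0; apply/matrixP => i j; rewrite mxE; apply: eq0_normc.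
by apply/eqP; rewrite eq_le normc_ge0 andbT -A0 entry_le_opnorm.
Qed.

Lemma opnormN A : opnorm (- A) = opnorm A.
Proof.
congr sup; apply/seteqP; split=> _ [v v1 <-]; exists v => //;
  by rewrite mulNmx vnormN.
Qed.

Lemma opnormD A B : opnorm (A + B) <= opnorm A + opnorm B.
Proof.
apply: ge_sup; first by exists 0; exact: opset0.
move=> _ [v /= v1 <-]; rewrite mulmxDl; apply: (le_trans (vnormD _ _)).
by apply: lerD; exact: opnorm_ub.
Qed.

End Norms.

Section Walks.
Variable R : realType.
Local Notation C := R[i].

Definition mx2 (a b c d : C) : 'M[C]_2 :=
  \matrix_(i, j) if i == 0 then (if j == 0 then a else b)
                 else (if j == 0 then c else d).

Definition Theta (alpha lambda : C) : 'M[C]_2 :=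
  let rho := (Num.sqrt (1 - normc alpha ^+ 2))%:C%C in
  lambda *: mx2 (alpha^*)%C rho rho (- alpha).

Definition is_Theta (Q : 'M[C]_2) : Prop :=
  exists alpha lambda : C,
    [/\ normc alpha < 1, normc lambda = 1 & Q = Theta alpha lambda].

Definition periodic (T : Type) (x : int -> T) : Prop :=
  exists2 p : nat, (0 < p)%N & forall n : int, x (n + p%:Z) = x n.

Definition limit_periodic (Q : int -> 'M[C]_2) : Prop :=
  exists P : nat -> int -> 'M[C]_2,
    (forall k, periodic (P k)) /\
    (forall eps : R, 0 < eps ->
      \forall k \near \oo, forall n, opnorm (Q n - P k n) <= eps).

Record walk := Walk {
  coin :> int -> 'M[C]_2;
  coin_limit_periodic : limit_periodic coin;
  coin_Theta : forall n, is_Theta (coin n);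
  coin_neq0 : forall n, coin n 0 0 != 0 /\ coin n 1 1 != 0 }.

HB.instance Definition _ := gen_eqMixin walk.
HB.instance Definition _ := gen_choiceMixin walk.

Definition walk_dist (Q Q' : walk) : R :=
  sup (range (fun n => opnorm (Q n - Q' n))).

Lemma walk_eq (Q Q' : walk) : (forall n, Q n = Q' n) -> Q = Q'.
Proof.
case: Q Q' => [q q1 q2 q3] [q' q1' q2' q3'] /= /funext qq'; subst q'.
by congr Walk; exact: Prop_irrelevance.
Qed.

Lemma Theta_entry_le1 (alpha lambda : C) i j :
  normc alpha < 1 -> normc lambda = 1 -> normc (Theta alpha lambda i j) <= 1.
Proof.
move=> a1 l1; rewrite /Theta mxE normcM l1 mul1r mxE.
have r1 : normc (Num.sqrt (1 - normc alpha ^+ 2))%:C%C <= 1.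
  rewrite /= expr0n addr0 sqrtr_sqr ger0_norm ?sqrtr_ge0//.
  by rewrite -[leRHS]sqrtr1 ler_wsqrtr// gerBl sqr_ge0.
by case: ifP => _; case: ifP => _; rewrite ?normcN ?normcJ' ?(ltW a1).
Qed.

Lemma walk_dist_has_sup (Q Q' : walk) :
  has_sup (range (fun n => opnorm (Q n - Q' n))).
Proof.
split; first by exists (opnorm (Q 0 - Q' 0)); exists 0.
exists (2 + 2 + (2 + 2)) => _ [n _ <-].
apply: (le_trans (opnorm_le_entries _)).
have h i j : normc ((Q n - Q' n) i j) <= 2.
  rewrite !mxE; apply: (le_trans (le_normcD _ _)); rewrite normcN.
  have [a [l [a1 l1 ->]]] := coin_Theta Q n.
  have [b [m [b1 m1 ->]]] := coin_Theta Q' n.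
  by have := Theta_entry_le1 i j a1 l1; have := Theta_entry_le1 i j b1 m1; lra.
by rewrite !lerD.
Qed.

Lemma walk_dist_ub (Q Q' : walk) n : opnorm (Q n - Q' n) <= walk_dist Q Q'.
Proof. by apply: ub_le_sup; [case: (walk_dist_has_sup Q Q')|exists n]. Qed.

Lemma walk_dist_le (Q Q' : walk) (e : R) :
  (forall n, opnorm (Q n - Q' n) <= e) -> walk_dist Q Q' <= e.
Proof.
move=> h; apply: ge_sup; first by case: (walk_dist_has_sup Q Q').
by move=> _ [n _ <-].
Qed.

Lemma walk_dist_ge0 (Q Q' : walk) : 0 <= walk_dist Q Q'.
Proof. exact: (le_trans (opnorm_ge0 _) (walk_dist_ub Q Q' 0)). Qed.

Lemma walk_distxx Q : walk_dist Q Q = 0.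
Proof.
apply/eqP; rewrite eq_le walk_dist_ge0 andbT.
by apply: walk_dist_le => n; rewrite subrr opnorm0.
Qed.

Lemma walk_dist_positivity Q Q' : walk_dist Q Q' = 0 -> Q = Q'.
Proof.
move=> d0; apply: walk_eq => n; apply/eqP; rewrite -subr_eq0; apply/eqP.
apply: opnorm_eq0; apply/eqP.
by rewrite eq_le opnorm_ge0 andbT -d0 walk_dist_ub.
Qed.

Lemma walk_dist_sym Q Q' : walk_dist Q Q' = walk_dist Q' Q.
Proof. by congr sup; apply: eq_imagel => n _; rewrite -opnormN opprB. Qed.

Lemma walk_dist_triangle Q' Q Q'' :
  walk_dist Q Q'' <= walk_dist Q Q' + walk_dist Q' Q''.
Proof.
apply: walk_dist_le => n; rewrite -[Q n](subrK (Q' n)) -addrA.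
by apply: (le_trans (opnormD _ _)); apply: lerD; exact: walk_dist_ub.
Qed.

HB.instance Definition _ := @isMetric.Build R walk walk_dist
  walk_distxx walk_dist_positivity walk_dist_sym walk_dist_triangle.

(* Component 0 of [psi n] is the coefficient of $\delta_n^+$, component 1 that
   of $\delta_n^-$. *)
Definition state := int -> 'cV[C]_2.

Definition l2 (psi : state) : Prop :=
  summable [set: int] (fun n => (vnorm (psi n) ^+ 2)%:E).

Definition delta (n : int) (s : 'I_2) : state :=
  fun m => if m == n then delta_mx s 0 else 0.

Definition phi (j : int) : state :=
  delta (j %/ 2)%Z (if (j %% 2)%Z == 0 then 0 else 1).

Definition symsum (V : nmodType) (N : nat) (f : int -> V) : V :=
  \sum_(k < N.*2.+1) f (k%:Z - N%:Z).

(* The series over $\mathbb Z$ converges absolutely for [l2] states, so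
   summing it symmetrically loses nothing. *)
Definition inner (u v : state) : C :=
  limn (fun N => symsum N (fun n => \sum_(s < 2) (u n s 0)^*%C * v n s 0)
    : C^o).

Definition shift_op (psi : state) : state := fun n =>
  \col_s (if s == 0 then psi (n - 1) 0 0 else psi (n + 1) 1 0).

Definition shift_inv (psi : state) : state := fun n =>
  \col_s (if s == 0 then psi (n + 1) 0 0 else psi (n - 1) 1 0).

Definition coin_op (Q : int -> 'M[C]_2) (psi : state) : state :=
  fun n => Q n *m psi n.

Definition update (Q : int -> 'M[C]_2) (psi : state) : state :=
  shift_op (coin_op Q psi).

Definition update_inv (Q : int -> 'M[C]_2) (psi : state) : state :=
  coin_op (fun n => invmx (Q n)) (shift_inv psi).

Definition update_pow (Q : int -> 'M[C]_2) (n : int) (psi : state) : state :=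
  match n with
  | Posz k => iter k (update Q) psi
  | Negz k => iter k.+1 (update_inv Q) psi
  end.

Lemma shift_opK : cancel shift_op shift_inv.
Proof.
move=> psi; apply/funext => n; apply/colP => s; rewrite !mxE.
by case: (ord2P s) => ->; rewrite /= ?addrK ?subrK.
Qed.

Lemma shift_invK : cancel shift_inv shift_op.
Proof.
move=> psi; apply/funext => n; apply/colP => s; rewrite !mxE.
by case: (ord2P s) => ->; rewrite /= ?addrK ?subrK.
Qed.

Lemma shift_delta_plus n : shift_op (delta n 0) = delta (n + 1) 0.
Proof.
apply/funext => m; apply/colP => s; rewrite mxE /delta subr_eq.
by case: (ord2P s) => -> /=; do 2?case: ifP => _; rewrite !mxE.
Qed.

Lemma shift_delta_minus n : shift_op (delta n 1) = delta (n - 1) 1.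
Proof.
apply/funext => m; apply/colP => s; rewrite mxE /delta.
have -> : (m == n - 1) = (m + 1 == n) by rewrite eq_sym subr_eq eq_sym.
by case: (ord2P s) => -> /=; do 2?case: ifP => _; rewrite !mxE.
Qed.

Lemma coin_delta Q n s :
  coin_op Q (delta n s) =
  fun m => \sum_(t < 2) Q n t s *: delta n t m.
Proof.
apply/funext => m; rewrite /coin_op /delta; case: eqP => [->|_]; last first.
  by rewrite mulmx0 big1// => t _; rewrite scaler0.
rewrite -colE; apply/colP => i; rewrite !mxE summxE (bigD1 i)//= big1 => [|t ti].
  by rewrite !mxE !eqxx mulr1 addr0.
by rewrite !mxE eq_sym (negbTE ti) mulr0.
Qed.

Lemma phi_even m : phi (2 * m) = delta m 0.
Proof. by rewrite /phi mulKz// modzMr. Qed.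

Lemma phi_odd m : phi (2 * m + 1) = delta m 1.
Proof. by rewrite /phi mulrC divzMDl// modzMDl addr0. Qed.

Lemma symsum_pick (V : nmodType) (N : nat) (j : int) (f : int -> V) :
  (`|j| <= N)%N -> (forall n, n != j -> f n = 0) -> symsum N f = f j.
Proof.
move=> jN f0; have kN : (`|(j + N%:Z)%R| < N.*2.+1)%N by lia.
rewrite /symsum (bigD1 (Ordinal kN))//= big1 ?addr0 => [|k kj].
  by congr f; lia.
by apply: f0; apply: contra kj => /eqP kj; apply/eqP/val_inj => /=; lia.
Qed.

Lemma inner_delta n s psi : inner (delta n s) psi = psi n s 0.
Proof.
rewrite /inner; apply: (@cvg_lim (C^o) (@norm_hausdorff _ _)); apply: cvg_near_cst; exists `|n|%N => // N /= nN.
rewrite (symsum_pick nN) => [|m mn].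
  rewrite /delta eqxx (bigD1 s)//= big1 ?addr0 => [|t ts].
    by rewrite !mxE !eqxx conjc1 mul1r.
  by rewrite !mxE (negbTE ts) conjc0 mul0r.
by rewrite big1// => t _; rewrite /delta (negbTE mn) mxE conjc0 mul0r.
Qed.

Lemma Theta_unitary (alpha lambda : C) : normc alpha < 1 -> normc lambda = 1 ->
  Theta alpha lambda *m (map_mx conjc (Theta alpha lambda))^T = 1%:M.
Proof.
move=> a1 l1; set rho := Num.sqrt (1 - normc alpha ^+ 2).
have rho2 : rho ^+ 2 = 1 - normc alpha ^+ 2.
  by rewrite sqr_sqrtr// subr_ge0 expr_le1// ?normc_ge0// ltW.
have l2 := normc_sq lambda; rewrite l1 in l2.
rewrite normc_sq in rho2.
apply/matrixP => i j; rewrite !mxE !big_ord_recl big_ord0 addr0.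
rewrite !mxE /= -/rho.
move: alpha lambda rho l2 rho2 {a1 l1} => [a b] [x y] /= r l2 r2.
have {}r2 : r ^+ 2 = 1 - a ^+ 2 - b ^+ 2 by rewrite r2 opprD addrA.
case: (ord2P i) => ->; case: (ord2P j) => -> /=; simpc; rewrite /=;
  apply/eqP; rewrite eq_complex /=; apply/andP; split; apply/eqP.
all: try ring.
all: transitivity ((x ^+ 2 + y ^+ 2) * (a ^+ 2 + b ^+ 2 + r ^+ 2)); first by ring.
all: by rewrite -l2 r2; ring.
Qed.

Lemma coin_unit (Q : walk) n : Q n \in unitmx.
Proof.
have [a [l [a1 l1 ->]]] := coin_Theta Q n.
by have /mulmx1_unit[] := Theta_unitary a1 l1; rewrite unitmx_tr.
Qed.

Lemma updateK (Q : walk) : cancel (update Q) (update_inv Q).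
Proof.
move=> psi; rewrite /update_inv /update shift_opK; apply/funext => n.
by rewrite /coin_op mulKmx// coin_unit.
Qed.

Lemma update_invK (Q : walk) : cancel (update_inv Q) (update Q).
Proof.
move=> psi; rewrite /update_inv /update -[RHS]shift_invK; congr shift_op.
by apply/funext => n; rewrite /coin_op mulKVmx// coin_unit.
Qed.

End Walks.

Arguments delta {R}.
Arguments phi {R}.

Definition baire_generic (T : topologicalType) (P : T -> Prop) : Prop :=
  exists G : set T, [/\ Gdelta G, dense G & forall x, G x -> P x].

(* Main.v *)
Require Import Defs.
From mathcomp Require Import all_boot all_order all_algebra.
From mathcomp Require Import all_classical all_reals all_analysis.
From mathcomp Require Import borel_hierarchy complex.
From mathcomp Require Import zify ring lra.
Import Order.TTheory GRing.Theory Num.Theory numFieldNormedType.Exports.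
Import Normc.
Set Implicit Arguments.
Unset Strict Implicit.
Unset Printing Implicit Defensive.
Local Open Scope classical_set_scope.
Local Open Scope ring_scope.

(* No spectral theory is needed. If for one N the averages over times t < N of
   |(U^t psi)(n)_s|^2 are at most e |psi|^2 uniformly in psi, then unitarity
   gives the same bound on every window of length N, hence on all long averages.
   Such a bound persists, with a worse e, under small perturbations of the
   coins, so the walks satisfying it for all n, s, e contain a countable
   intersection of open sets that each contain all periodic walks; the latter
   are dense.

   For a p-periodic walk, the 2x2 monodromy matrix of the transfer matrices has
   unimodular determinant kap and trace Delta(z), a Laurent polynomial in the
   time shift z. By Cayley-Hamilton, c_m(t) = (U^t psi)(n + m p)_s satisfies
   c_(m+1) + kap c_(m-1) = Delta(U) c_m, with Delta = kap Delta^* on the unit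
   circle. The time correlations of c_m and c_m' thus solve, up to a boundary
   term independent of N, a discrete wave equation in (m, m'); since they are
   summable along diagonals by Bessel's inequality, they are o(N). *)

(** * Laurent polynomials in the time shift and their adjoints *)

Section LaurentPolynomials.
Variable R : realType.
Local Notation C := R[i].
Implicit Types (x y : int -> C) (c : C) (k : int).

Lemma ler_normcD (z w : C) : normc (z + w) <= normc z + normc w.
Proof. exact: le_normcD. Qed.

Lemma normcB_le (z w : C) : normc (z - w) <= normc z + normc w.
Proof. by rewrite -(normcN w); exact: le_normcD. Qed.

Lemma normc_sum (I : Type) (s : seq I) (f : I -> C) :
  normc (\sum_(i <- s) f i) <= \sum_(i <- s) normc (f i).
Proof.
elim: s => [|i s IH]; first by rewrite !big_nil normc0.
rewrite !big_cons; apply: le_trans (ler_normcD _ _) _; exact: lerD.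
Qed.

Lemma normc_mul_conj_le (z w : C) :
  normc (z * w^*%C) *+ 2 <= normc z ^+ 2 + normc w ^+ 2.
Proof.
rewrite normcM normcJ' -subr_ge0.
have -> : normc z ^+ 2 + normc w ^+ 2 - (normc z * normc w) *+ 2 =
  (normc z - normc w) ^+ 2 by rewrite sqrrB addrAC.
exact: sqr_ge0.
Qed.

(* [:: (c, k); ...] stands for the Laurent polynomial with terms c z^k, which
   acts on sequences with z as the left shift. *)
Definition laurent := seq (C * int).
Implicit Type l : laurent.

Definition act l x : int -> C := fun t => \sum_(p <- l) p.1 * x (t + p.2).

Definition lscale c k l : laurent := [seq (c * p.1, k + p.2) | p <- l].

Definition lstar l : laurent := [seq (p.1^*%C, - p.2) | p <- l].

(** Controls boundary terms: moving z^k across a sum over a time window changes [|k|] terms at each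
    end. *)
Definition lweight l : R := \sum_(p <- l) normc p.1 * `|p.2|%N%:R.

Lemma lweight_ge0 l : 0 <= lweight l.
Proof. by apply: sumr_ge0 => p _; rewrite mulr_ge0 ?normc_ge0. Qed.

Lemma act_cat l1 l2 x t : act (l1 ++ l2) x t = act l1 x t + act l2 x t.
Proof. exact: big_cat. Qed.

Lemma act_lscale c k l x t : act (lscale c k l) x t = c * act l x (t + k).
Proof.
rewrite /act big_map mulr_sumr; apply: eq_bigr => p _ /=.
by rewrite mulrA addrA.
Qed.

Lemma act_lstar_cat l1 l2 x t :
  act (lstar (l1 ++ l2)) x t = act (lstar l1) x t + act (lstar l2) x t.
Proof. by rewrite /lstar map_cat act_cat. Qed.

Lemma act_lstar_lscale c k l x t :
  act (lstar (lscale c k l)) x t = c^*%C * act (lstar l) x (t - k).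
Proof.
rewrite /act /lstar /lscale !big_map mulr_sumr; apply: eq_bigr => p _ /=.
by rewrite rmorphM mulrA opprD addrA.
Qed.

Lemma act_shift l x k t : act l (fun s => x (s + k)) t = act l x (t + k).
Proof. by apply: eq_bigr => p _; rewrite addrAC. Qed.

Lemma act_comb l a b x y t :
  act l (fun s => a * x s + b * y s) t = a * act l x t + b * act l y t.
Proof.
rewrite /act !mulr_sumr -big_split; apply: eq_bigr => p _ /=.
by rewrite mulrDr !(mulrCA p.1).
Qed.

Definition corr (N : nat) x y : C :=
  \sum_(t < N) x t%:Z * (y t%:Z)^*%C.

Lemma sum_shift_le (N : nat) (f : int -> C) (b : R) k :
  (forall t, normc (f t) <= b) ->
  normc (\sum_(t < N) f (t%:Z + k) - \sum_(t < N) f t%:Z) <=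
    (`|k|%N%:R * b) *+ 2.
Proof.
move=> fb.
have key n j : normc (\sum_(t < N) f (t%:Z + (j + n%:Z)) -
    \sum_(t < N) f (t%:Z + j)) <= (n%:R * b) *+ 2.
  elim: n => [|n IH].
    rewrite mul0r mul0rn; under eq_bigr do rewrite addr0.
    by rewrite subrr normc0.
  pose g m := f (m%:Z + (j + n%:Z)).
  have step : \sum_(t < N) f (t%:Z + (j + n.+1%:Z)) -
      \sum_(t < N) f (t%:Z + (j + n%:Z)) = g N - g 0%N.
    rewrite -(telescope_sumr g (leq0n N)) big_mkord -sumrB.
    by apply: eq_bigr => t _; congr (f _ - _); lia.
  rewrite -(subrKA (\sum_(t < N) f (t%:Z + (j + n%:Z)))) step.
  apply: le_trans (ler_normcD _ _) _.
  rewrite -[n.+1]add1n natrD mulrDl mul1r mulrnDl.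
  apply: (lerD _ IH).
  by apply: le_trans (normcB_le _ _) _; rewrite mulr2n; apply: lerD; exact: fb.
case: (lerP 0 k) => k0.
  have := key `|k|%N 0; rewrite add0r gez0_abs//.
  by under [X in _ - X]eq_bigr do rewrite addr0.
(* For negative k, start at offset k and shift up by [|k|], which ends at 0. *)
have := key `|k|%N k; rewrite ltz0_abs// subrr -normcN opprB.
by under [X in _ - X]eq_bigr do rewrite addr0.
Qed.

(* Up to boundary terms, the adjoint of a Laurent polynomial acting on
   sequences is its star. *)
Lemma corr_act_lstar (N : nat) l x y (b : R) :
  (forall s t, normc (x s * (y t)^*%C) <= b) ->
  normc (corr N (act l x) y - corr N x (act (lstar l) y)) <=
    (lweight l * b) *+ 2.
Proof.
move=> xyb; pose g (p : C * int) t := p.1 * (x t * (y (t - p.2))^*%C).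
have -> : corr N (act l x) y - corr N x (act (lstar l) y) =
    \sum_(p <- l) (\sum_(t < N) g p (t%:Z + p.2) - \sum_(t < N) g p t%:Z).
  rewrite sumrB; congr (_ - _); rewrite /corr exchange_big;
    apply: eq_bigr => t _.
    by rewrite mulr_suml; apply: eq_bigr => p _; rewrite /g addrK mulrA.
  rewrite /act big_map rmorph_sum mulr_sumr; apply: eq_bigr => p _ /=.
  by rewrite rmorphM /= conjcK mulrCA.
apply: le_trans (normc_sum _ _) _.
rewrite /lweight mulr_suml -sumrMnl; apply: ler_sum => p _.
have -> : normc p.1 * `|p.2|%N%:R * b = `|p.2|%N%:R * (normc p.1 * b)
  by rewrite -mulrA mulrCA.
apply: (@sum_shift_le N (g p) (normc p.1 * b)) => t.
by rewrite normcM ler_wpM2l ?normc_ge0.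
Qed.

End LaurentPolynomials.

(** * Decay for an approximate discrete wave equation *)

(* [corr N (c m) (c m')] almost solves the wave equation
   G(m+1,m') + kap G(m-1,m') = G(m,m'-1) + kap G(m,m'+1), whose symbol factors
   as (S - S'^-1) (1 - kap S^-1 S') in the two shifts S and S'. Each factor
   lets one average along a diagonal, where G is summable. *)
Section WaveEquation.
Variables (R : realType).
Local Notation C := R[i].
Variables (c : int -> int -> C) (B : R) (l : laurent R) (kap : C) (N : nat).

Hypothesis bessel : forall t n (f : 'I_n -> int), injective f ->
  \sum_(i < n) normc (c (f i) t) ^+ 2 <= B.
Hypothesis recurrence : forall m t,
  c (m + 1) t + kap * c (m - 1) t = act l (c m) t.
Hypothesis l_star : forall x t, act l x t = kap * act (lstar l) x t.
Hypothesis kap1 : kap * kap^*%C = 1.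

Let G m m' := corr N (c m) (c m').
Let E m m' := G m m' - kap * G (m - 1) (m' + 1).
Let K := (lweight l * B) *+ 2.

Let kap_norm : normc kap = 1.
Proof.
have /(congr1 (@normc R)) := kap1.
rewrite normcM normcJ' normc1 -expr2 => /eqP; rewrite sqrf_eq1 => /orP[/eqP//|].
by move=> /eqP k1; have := normc_ge0 kap; rewrite k1 oppr_ge0 ler10.
Qed.

Let c_sq_le m t : normc (c m t) ^+ 2 <= B.
Proof.
have := @bessel t 1 (fun=> m); rewrite big_ord1; apply.
by move=> i j _; rewrite !ord1.
Qed.

Let B_ge0 : 0 <= B.
Proof. exact: le_trans (sqr_ge0 _) (c_sq_le 0 0). Qed.

Let K_ge0 : 0 <= K.
Proof. by rewrite mulrn_wge0// mulr_ge0// lweight_ge0. Qed.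

Let c_mul_le m m' s t : normc (c m s * (c m' t)^*%C) <= B.
Proof.
have := normc_mul_conj_le (c m s) (c m' t).
by have := c_sq_le m s; have := c_sq_le m' t; lra.
Qed.

(** The recurrence in m and the conjugated one in m' let [l] act on either side of the correlation;
    [l_star] and |kap| = 1 match [l] with its adjoint, and [K] pays for the boundary terms. *)
Let wave m m' :
  normc (G (m + 1) m' + kap * G (m - 1) m' -
         (kap * G m (m' + 1) + G m (m' - 1))) <= K.
Proof.
have -> : G (m + 1) m' + kap * G (m - 1) m' = corr N (act l (c m)) (c m').
  rewrite /G /corr mulr_sumr -big_split; apply: eq_bigr => t _ /=.
  by rewrite -recurrence mulrDl mulrA.
have -> : kap * G m (m' + 1) + G m (m' - 1) =
    corr N (c m) (act (lstar l) (c m')).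
  rewrite /G /corr mulr_sumr -big_split; apply: eq_bigr => t _ /=.
  have -> : act (lstar l) (c m') t%:Z = kap^*%C * act l (c m') t%:Z.
    by rewrite l_star mulrA (mulrC kap^*%C) kap1 mul1r.
  rewrite -recurrence rmorphM rmorphD rmorphM /= conjcK.
  by rewrite mulrDr (mulrA kap kap^*%C) kap1 mul1r mulrDr (mulrCA _ kap).
exact: corr_act_lstar.
Qed.

(** The expression in [wave], taken at (m, m' + 1), is the difference of two diagonal neighbours of
    [E]: this is the factor S - S'^-1. *)
Let E_step m m' : normc (E m m') <= normc (E (m + 1) (m' + 1)) + K.
Proof.
have -> : E m m' = E (m + 1) (m' + 1) - (E (m + 1) (m' + 1) - E m m').
  by rewrite opprB addrC subrK.
apply: le_trans (normcB_le _ _) _; rewrite lerD2l.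
apply: le_trans (wave m (m' + 1)); rewrite /E !addrK le_eqVlt; apply/orP; left.
apply/eqP; congr normc.
by rewrite opprB opprD addrACA.
Qed.

Let E_diag k m m' :
  normc (E m m') <= normc (E (m + k%:Z) (m' + k%:Z)) + k%:R * K.
Proof.
elim: k => [|k IH]; first by rewrite !addr0 mul0r addr0.
apply: (le_trans IH); apply: le_trans (lerD (E_step _ _) (lexx _)) _.
have -> : k.+1%:R * K = K + k%:R * K by rewrite -add1n natrD mulrDl mul1r.
by rewrite [leRHS]addrA -!addrA -PoszD addn1.
Qed.

(** Solving the definition of [E] for [G] gives one step along the antidiagonal, at cost e because
    |kap| = 1. *)
Let G_antidiag e k : (forall m m', normc (E m m') <= e) ->
  normc (G 0 0) <= normc (G (- k%:Z) k%:Z) + k%:R * e.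
Proof.
move=> Ee; elim: k => [|k IH]; first by rewrite mul0r addr0 oppr0.
apply: (le_trans IH).
have -> : k.+1%:R * e = e + k%:R * e by rewrite -add1n natrD mulrDl mul1r.
rewrite addrA lerD2r.
have -> : G (- k%:Z) k%:Z =
    kap * G (- k.+1%:Z) k.+1%:Z + E (- k%:Z) k%:Z.
  rewrite /E [RHS]addrC (_ : - k.+1%:Z = - k%:Z - 1); last by lia.
  by rewrite (_ : k.+1%:Z = k%:Z + 1) ?subrK//; lia.
by apply: le_trans (ler_normcD _ _) _; rewrite normcM kap_norm mul1r lerD2l.
Qed.

(** AM-GM separates the two factors and [bessel] applies at each time. The bound is independent of
    n, so averaging over many positions gains. *)
Let G_sum n (f g : 'I_n -> int) : injective f -> injective g ->
  \sum_(i < n) normc (G (f i) (g i)) <= N%:R * B.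
Proof.
move=> f_inj g_inj.
have : \sum_(i < n) normc (G (f i) (g i)) <=
    \sum_(i < n) \sum_(t < N) normc (c (f i) t%:Z * (c (g i) t%:Z)^*%C).
  by apply: ler_sum => i _; exact: normc_sum.
move=> /le_trans; apply; rewrite exchange_big /=.
have -> : N%:R * B = \sum_(t < N) B by rewrite sumr_const card_ord mulr_natl.
apply: ler_sum => t _.
rewrite -(@ler_pMn2r _ 2)// -sumrMnl.
have : \sum_(i < n) normc (c (f i) t%:Z * (c (g i) t%:Z)^*%C) *+ 2 <=
    \sum_(i < n) (normc (c (f i) t%:Z) ^+ 2 + normc (c (g i) t%:Z) ^+ 2).
  by apply: ler_sum => i _; exact: normc_mul_conj_le.
move=> /le_trans; apply; rewrite big_split mulr2n; apply: lerD; exact: bessel.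
Qed.

Let ramp_sum (L : nat) (e : R) : 0 <= e ->
  \sum_(k < L) k%:R * e <= L%:R ^+ 2 * e.
Proof.
move=> e0; rewrite expr2 -mulrA.
have -> : L%:R * (L%:R * e) = \sum_(k < L) L%:R * e.
  by rewrite sumr_const card_ord mulr_natl.
by apply: ler_sum => k _; rewrite ler_wpM2r// ler_nat ltnW.
Qed.

Let addz_inj (a : int) n : injective (fun k : 'I_n => a + (k : nat)%:Z).
Proof. by move=> i j /addrI[] /val_inj. Qed.

Let subz_inj (a : int) n : injective (fun k : 'I_n => a - (k : nat)%:Z).
Proof. by move=> i j /addrI /oppr_inj[] /val_inj. Qed.

Let E_le L m m' :
  L%:R * normc (E m m') <= (N%:R * B) *+ 2 + L%:R ^+ 2 * K.
Proof.
have -> : L%:R * normc (E m m') = \sum_(k < L) normc (E m m').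
  by rewrite sumr_const card_ord mulr_natl.
have : \sum_(k < L) normc (E m m') <= \sum_(k < L)
   (normc (G (m + k%:Z) (m' + k%:Z)) +
    normc (G (m - 1 + k%:Z) (m' + 1 + k%:Z)) + k%:R * K).
  apply: ler_sum => k _; apply: le_trans (E_diag k m m') _; rewrite lerD2r.
  apply: le_trans (normcB_le _ _) _.
  by rewrite normcM kap_norm mul1r !(addrAC _ k%:Z).
move=> /le_trans; apply; rewrite !big_split mulr2n /=.
by rewrite lerD ?ramp_sum// lerD// G_sum//; exact: addz_inj.
Qed.

Let G_le e L : (forall m m', normc (E m m') <= e) ->
  L%:R * normc (G 0 0) <= N%:R * B + L%:R ^+ 2 * e.
Proof.
move=> Ee.
have e0 : 0 <= e by exact: le_trans (normc_ge0 _) (Ee 0 0).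
have -> : L%:R * normc (G 0 0) = \sum_(k < L) normc (G 0 0).
  by rewrite sumr_const card_ord mulr_natl.
have : \sum_(k < L) normc (G 0 0) <= \sum_(k < L)
   (normc (G (0 - k%:Z) (0 + k%:Z)) + k%:R * e).
  by apply: ler_sum => k _; rewrite sub0r add0r; exact: G_antidiag.
move=> /le_trans; apply; rewrite big_split lerD ?ramp_sum//.
by apply: G_sum; [exact: subz_inj|exact: addz_inj].
Qed.

Lemma wave_decay (M : nat) : (0 < M)%N -> 4 * lweight l * M%:R ^+ 4 <= N%:R ->
  M%:R * normc (corr N (c 0) (c 0)) <= 3 * N%:R * B.
Proof.
move=> M0 MN; have M0' : 0 < M%:R :> R by rewrite ltr0n.
(* [L] is the length of the diagonal average, M that of the antidiagonal one. The antidiagonal sum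
   contributes N B, the diagonal sums another N B, and the error from [K] is 4 [lweight l] M^4 B, at
   most N B by assumption. *)
pose L := (2 * M ^ 2)%N; pose e := (N%:R * B *+ 2 + L%:R ^+ 2 * K) / L%:R.
have LE : L%:R = 2 * M%:R ^+ 2 :> R by rewrite natrM natrX.
have L0 : 0 < L%:R :> R by rewrite LE mulr_gt0// exprn_gt0.
apply: (le_trans (@G_le e M _)) => [m m'|].
  by rewrite ler_pdivlMr// mulrC E_le.
have -> : 3 * N%:R * B = N%:R * B + 2 * N%:R * B.
  by ring.
rewrite lerD2l /e LE mulrA ler_pdivrMr ?mulr_gt0 ?exprn_gt0//.
suff : K * (4 * M%:R ^+ 4) <= 2 * (N%:R * B).
  move=> KM; have -> : 2 * N%:R * B * (2 * M%:R ^+ 2) =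
    M%:R ^+ 2 * (N%:R * B *+ 2 + 2 * (N%:R * B)) by ring.
  by rewrite ler_wpM2l ?sqr_ge0// lerD2l; apply: le_trans KM;
    rewrite (_ : _ * K = K * (4 * M%:R ^+ 4))//; ring.
have -> : K * (4 * M%:R ^+ 4) = 2 * ((4 * lweight l * M%:R ^+ 4) * B).
  by rewrite /K; ring.
by rewrite ler_wpM2l// ler_wpM2r.
Qed.

End WaveEquation.

(** * Unitarity of the walk, expressed by finite partial sums *)

Section Walks.
Variable R : realType.
Local Notation C := R[i].
Implicit Types (psi : state R) (Q : walk R) (B : R).

Lemma ler_sum_uniq (I : eqType) (s u : seq I) (f : I -> R) :
  (forall i, 0 <= f i) -> uniq s -> uniq u -> {subset s <= u} ->
  \sum_(i <- s) f i <= \sum_(i <- u) f i.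
Proof.
move=> f0 us uu su.
have -> : \sum_(i <- s) f i = \sum_(i <- u | i \in s) f i.
  rewrite -[RHS]big_filter; apply/perm_big/uniq_perm => //.
    exact: filter_uniq.
  by move=> i; rewrite mem_filter; case: (boolP (i \in s)) => // /su ->.
by rewrite [leRHS](bigID (mem s)) lerDl sumr_ge0.
Qed.

(** Says that the squared norm is at most B without an infinite sum, so that unitarity reduces to
    rearranging finite sums. *)
Definition sq_bounded B psi := forall s : seq int, uniq s ->
  \sum_(n <- s) vnorm (psi n) ^+ 2 <= B.

Lemma l2_sq_bounded psi : l2 psi -> exists B, sq_bounded B psi.
Proof.
rewrite /l2 summableE => fin.
exists (fine (\esum_(n in [set: int]) `|(vnorm (psi n) ^+ 2)%:E|%E)) => s us.
rewrite -lee_fin (fineK fin) -sumEFin; apply: esum_ge.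
exists [set` s].
  by split; [exact: finite_seq|].
rewrite -fsbig_seq// le_eqVlt; apply/orP; left; apply/eqP.
by apply: eq_bigr => n _; rewrite gee0_abs// lee_fin sqr_ge0.
Qed.

Lemma sq_bounded_ge0 B psi : sq_bounded B psi -> 0 <= B.
Proof. by move=> /(_ [::] isT); rewrite big_nil. Qed.

Lemma sq_bounded_inj B psi n (f : 'I_n -> int) : sq_bounded B psi ->
  injective f -> \sum_(i < n) vnorm (psi (f i)) ^+ 2 <= B.
Proof.
move=> psiB f_inj; rewrite -(big_map f xpredT (fun m => vnorm (psi m) ^+ 2)).
by apply: psiB; rewrite map_inj_uniq// index_enum_uniq.
Qed.

Lemma sq_bounded_vnorm B psi n : sq_bounded B psi -> vnorm (psi n) ^+ 2 <= B.
Proof. by move=> /(_ [:: n] isT); rewrite big_seq1. Qed.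

(** Covers the shift and its inverse. Each component reads distinct sites of the union [u] of the
    two images, and squared components add up. *)
Lemma sq_bounded_shuffle B psi (f0 f1 : int -> int) :
  injective f0 -> injective f1 -> sq_bounded B psi ->
  sq_bounded B
    (fun n => \col_s (if s == 0 then psi (f0 n) 0 0 else psi (f1 n) 1 0)).
Proof.
move=> f0_inj f1_inj psiB s us.
set u := undup (map f0 s ++ map f1 s).
apply: le_trans (psiB u (undup_uniq _)).
under eq_bigr do rewrite vnorm_sq !mxE /=.
under [leRHS]eq_bigr do rewrite vnorm_sq.
rewrite !big_split /=; apply: lerD.
- rewrite -(big_map f0 xpredT (fun m => normc (psi m 0 0) ^+ 2)).
  apply: ler_sum_uniq; rewrite ?undup_uniq ?map_inj_uniq//.
    by move=> m; exact: sqr_ge0.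
  by move=> m ms; rewrite mem_undup mem_cat ms.
- rewrite -(big_map f1 xpredT (fun m => normc (psi m 1 0) ^+ 2)).
  apply: ler_sum_uniq; rewrite ?undup_uniq ?map_inj_uniq//.
    by move=> m; exact: sqr_ge0.
  by move=> m ms; rewrite mem_undup mem_cat ms orbT.
Qed.

Lemma coin_unitary Q n : Q n *m (map_mx conjc (Q n))^T = 1%:M.
Proof. by have [a [l [a1 l1 ->]]] := coin_Theta Q n; exact: Theta_unitary. Qed.

Lemma vnorm_sq_mx (v : 'cV[C]_2) :
  (vnorm v ^+ 2)%:C%C = ((map_mx conjc v)^T *m v) 0 0.
Proof.
have sqC z : (normc z ^+ 2)%:C%C = z^*%C * z :> C.
  case: z => a b /=; rewrite sqr_sqrtr ?addr_ge0 ?sqr_ge0//; simpc.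
  by congr Complex; ring.
rewrite vnorm_sq rmorphD /= !sqC mxE !big_ord_recl big_ord0 addr0 !mxE.
by congr (_ + (v _ 0)^*%C * v _ 0); apply/val_inj.
Qed.

Lemma vnorm_coin Q n v : vnorm (Q n *m v) = vnorm v.
Proof.
have sq : (vnorm (Q n *m v) ^+ 2)%:C%C = (vnorm v ^+ 2)%:C%C :> C.
  rewrite !vnorm_sq_mx map_mxM trmx_mul -mulmxA (mulmxA _ (Q n)).
  by rewrite (mulmx1C (coin_unitary Q n)) mul1mx.
have /eqP := complexI sq.
by rewrite eqrXn2// ?vnorm_ge0// => /eqP.
Qed.

Lemma sq_bounded_update Q B psi :
  sq_bounded B psi -> sq_bounded B (update Q psi).
Proof.
move=> psiB; apply: sq_bounded_shuffle; try by move=> i j /addIr.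
by move=> s us; under eq_bigr do rewrite vnorm_coin; exact: psiB.
Qed.

Lemma sq_bounded_update_inv Q B psi :
  sq_bounded B psi -> sq_bounded B (update_inv Q psi).
Proof.
move=> psiB s us.
under eq_bigr => n _ do rewrite -(vnorm_coin Q n) mulKVmx ?coin_unit//.
by apply: sq_bounded_shuffle us => // i j /addIr.
Qed.

Lemma update_powS Q (t : int) psi :
  update_pow Q (t + 1) psi = update Q (update_pow Q t psi).
Proof.
case: t => [k|[|k]]; first by rewrite -PoszD addn1.
  by rewrite /= update_invK.
by rewrite (_ : Negz k.+1 + 1 = Negz k)/= ?update_invK//; lia.
Qed.

Lemma update_powD Q (t : int) k psi :
  update_pow Q (t + k%:Z) psi = iter k (update Q) (update_pow Q t psi).
Proof.
elim: k => [|k IH]; first by rewrite addr0.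
by rewrite -addn1 PoszD addrA update_powS IH addn1.
Qed.

Lemma sq_bounded_pow Q (t : int) B psi :
  sq_bounded B psi -> sq_bounded B (update_pow Q t psi).
Proof.
move=> psiB; case: t => k /=.
  by elim: k => //= k; exact: sq_bounded_update.
rewrite -iterS; elim: k.+1 => //= {}k; exact: sq_bounded_update_inv.
Qed.

End Walks.

(** * Transfer and monodromy matrices *)

(** The algebra behind [tm_star]: p, q, r are the entries of a symmetric unitary matrix and the
    primed letters their conjugates, treated as independent variables. *)
Lemma symmetric_unitary_quotients (F : fieldType) (p q r p' q' r' : F) :
  r != 0 -> r' != 0 -> p * p' + q * q' = 1 -> q * q' + r * r' = 1 ->
  p * q' + q * r' = 0 ->
  [/\ p / r * (p' / r') = 1, - (q / r) = - (p / r * - (q' / r')),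
      - r^-1 = - (p / r * ((p' * r' - q' * q') / r')) &
      (p * r - q * q) / r = - (p / r * - r'^-1)].
Proof.
move=> r0 r'0 e1 e2 e3.
have pp' : p * p' = r * r' by apply: (addIr (q * q')); rewrite e1 addrC e2.
have qr' : q * r' = - (p * q') by rewrite -(addKr (p * q') (q * r')) e3 addr0.
split.
- by rewrite mulrACA pp' -invfM divff ?mulf_neq0.
- have -> : q = - (p * q') / r' by [rewrite -qr' mulfK].
  by field; rewrite ?r0 ?r'0.
- apply: (mulfI (mulf_neq0 r0 r'0)).
  have -> : r * r' * - r^-1 = - (r' * (p * p' + q * q')) by
    rewrite e1; field; rewrite ?r0 ?r'0.
  have -> : r' * (p * p' + q * q') = p * p' * r' + q' * (q * r') by ring.
  by rewrite qr'; field; rewrite ?r0 ?r'0.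
- apply: (mulfI (mulf_neq0 r0 r'0)).
  have -> : r * r' * - (p / r * - r'^-1) = p * (q * q' + r * r').
    by rewrite e2; field; rewrite ?r0 ?r'0.
  have -> : p * (q * q' + r * r') = q * (p * q') + p * r * r' by ring.
  by rewrite -(opprK (p * q')) -qr'; field; rewrite ?r0 ?r'0.
Qed.

(* Eliminating [(U psi)(n)] from the update rule gives, with z the time shift,
   (X0 (n+1), X1 (n+1)) = M_n(z) (X0 n, X1 n), where X0 n t = (U^t psi)(n)_0,
   X1 n t = (U^t psi)(n-1)_1 and M_n(z) = [[a z^-1, -b], [b, -d z]] for the
   coefficients [tm_a], [tm_b], [tm_d]; its determinant is [tm_det]. *)
Section Transfer.
Variable R : realType.
Local Notation C := R[i].
Implicit Types (A : 'M[C]_2) (e : laurent R * laurent R).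

Definition tm_a A := (A 0 0 * A 1 1 - A 0 1 * A 1 0) / A 1 1.
Definition tm_b A := - (A 0 1 / A 1 1).
Definition tm_d A := - (A 1 1)^-1.
Definition tm_det A := A 0 0 / A 1 1.

Variable Q : walk R.

Let sym n : Q n 1 0 = Q n 0 1.
Proof. by have [a [l [_ _ ->]]] := coin_Theta Q n; rewrite !mxE. Qed.

Let Q11_neq0 n : Q n 1 1 != 0.
Proof. by case: (coin_neq0 Q n). Qed.

Let unitary_entry n i j :
  Q n i 0 * (Q n j 0)^*%C + Q n i 1 * (Q n j 1)^*%C = (i == j)%:R.
Proof.
have /matrixP/(_ i j) := coin_unitary Q n.
rewrite !mxE !big_ord_recl big_ord0 addr0 !mxE.
by have -> : lift ord0 ord0 = 1 :> 'I_2 by apply/val_inj.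
Qed.

Let Q11_conj_neq0 n : (Q n 1 1)^*%C != 0.
Proof. by rewrite fmorph_eq0. Qed.

Lemma tm_detE n :
  tm_det (Q n) = tm_b (Q n) * tm_b (Q n) - tm_a (Q n) * tm_d (Q n).
Proof. by rewrite /tm_det /tm_b /tm_a /tm_d sym; field. Qed.

Lemma tm_star n : let A := Q n in
  [/\ tm_det A * (tm_det A)^*%C = 1,
      tm_b A = - (tm_det A * (tm_b A)^*%C),
      tm_d A = - (tm_det A * (tm_a A)^*%C) &
      tm_a A = - (tm_det A * (tm_d A)^*%C)].
Proof.
have u00 := unitary_entry n 0 0; have u01 := unitary_entry n 0 1.
have u11 := unitary_entry n 1 1; move: u01 u11; rewrite sym => u01 u11.
have := symmetric_unitary_quotients (Q11_neq0 n) (Q11_conj_neq0 n) u00 u11 u01.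
rewrite /tm_det /tm_b /tm_d /tm_a sym.
by rewrite !rmorphN !rmorphM rmorphB !rmorphM !fmorphV.
Qed.

(** Left multiplication by M_n(z) of a column of Laurent polynomials. *)
Definition tm_step A e : laurent R * laurent R :=
  (lscale (tm_a A) (-1) e.1 ++ lscale (- tm_b A) 0 e.2,
   lscale (tm_b A) 0 e.1 ++ lscale (- tm_d A) 1 e.2).

Fixpoint monodromy (n : int) (k : nat) e :=
  if k is k'.+1 then tm_step (Q (n + k'%:Z)) (monodromy n k' e) else e.

Definition monodromy_det (n : int) (k : nat) : C :=
  \prod_(i < k) tm_det (Q (n + (i : nat)%:Z)).

Let col0 n k := monodromy n k ([:: (1, 0)], [::]).
Let col1 n k := monodromy n k ([::], [:: (1, 0)]).

Let act_step1 A e x t : act (tm_step A e).1 x t =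
  tm_a A * act e.1 x (t - 1) - tm_b A * act e.2 x t.
Proof. by rewrite act_cat !act_lscale addr0 (mulNr (tm_b A)). Qed.

Let act_step2 A e x t : act (tm_step A e).2 x t =
  tm_b A * act e.1 x t - tm_d A * act e.2 x (t + 1).
Proof. by rewrite act_cat !act_lscale addr0 (mulNr (tm_d A)). Qed.

Let star_step1 A e x t : act (lstar (tm_step A e).1) x t =
  (tm_a A)^*%C * act (lstar e.1) x (t + 1) -
  (tm_b A)^*%C * act (lstar e.2) x t.
Proof.
by rewrite act_lstar_cat !act_lstar_lscale opprK subr0 (rmorphN _ (tm_b A))
  (mulNr (tm_b A)^*%C).
Qed.

Let star_step2 A e x t : act (lstar (tm_step A e).2) x t =
  (tm_b A)^*%C * act (lstar e.1) x t -
  (tm_d A)^*%C * act (lstar e.2) x (t - 1).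
Proof.
by rewrite act_lstar_cat !act_lstar_lscale subr0 (rmorphN _ (tm_d A))
  (mulNr (tm_d A)^*%C).
Qed.

Let act_one x t : act [:: (1 : C, 0)] x t = x t.
Proof. by rewrite /act big_seq1 mul1r addr0. Qed.

Let act_nil (x : int -> C) t : act [::] x t = 0.
Proof. by rewrite /act big_nil. Qed.

Let star_nil (x : int -> C) t : act (lstar [::]) x t = 0.
Proof. exact: act_nil. Qed.

Let star_one x t : act (lstar [:: (1 : C, 0)]) x t = x t.
Proof.
rewrite /act big_map big_seq1 -[X in X * _]/((1 : C)^*%C) conjc1 mul1r.
by rewrite -[X in t + X]/(- 0) oppr0 addr0.
Qed.

(** For |z| = 1 this places the monodromy matrix in U(1,1): it is its determinant times its
    entrywise conjugate with both indices flipped. One factor satisfies this by [tm_star], and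
    products preserve it. *)
Lemma monodromy_star n k x t :
  [/\ act (col0 n k).1 x t =
        monodromy_det n k * act (lstar (col1 n k).2) x t,
      act (col1 n k).2 x t =
        monodromy_det n k * act (lstar (col0 n k).1) x t,
      act (col0 n k).2 x t =
        monodromy_det n k * act (lstar (col1 n k).1) x t &
      act (col1 n k).1 x t =
        monodromy_det n k * act (lstar (col0 n k).2) x t].
Proof.
elim: k t => [|k IH] t.
  rewrite /monodromy_det big_ord0 /= !star_one !act_one !mul1r.
  by rewrite !star_nil.
have [e1 e2 e3 e4] := IH t; have [f1 f2 f3 f4] := IH (t - 1).
have [g1 g2 g3 g4] := IH (t + 1).
rewrite /monodromy_det big_ord_recr -/(monodromy_det n k) /col0 /col1 /=.
rewrite -/(col0 n k) -/(col1 n k) !act_step1 !act_step2 !star_step1 !star_step2.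
rewrite e1 e2 e3 e4 f1 f4 g2 g3.
have [_ b_star d_star a_star] := tm_star (n + k%:Z).
move: b_star d_star a_star; move: (tm_det _) => D b_star d_star a_star.
split; [rewrite {1}a_star {1}b_star|rewrite {1}b_star {1}d_star|
        rewrite {1}b_star {1}d_star|rewrite {1}a_star {1}b_star]; ring.
Qed.

(* The trace of the monodromy matrix. *)
Definition discriminant n k : laurent R := (col0 n k).1 ++ (col1 n k).2.

Lemma discriminant_star n k x t : act (discriminant n k) x t =
  monodromy_det n k * act (lstar (discriminant n k)) x t.
Proof.
have [e1 e2 _ _] := monodromy_star n k x t.
by rewrite act_lstar_cat act_cat e1 e2 -mulrDr addrC.
Qed.

Lemma monodromy_det_norm n k :
  monodromy_det n k * (monodromy_det n k)^*%C = 1.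
Proof.
rewrite /monodromy_det rmorph_prod -big_split big1// => i _.
by have [] := tm_star (n + (i : nat)%:Z).
Qed.

Lemma monodromy_periodic n n' k e :
  (forall i, Q (n + i) = Q (n' + i)) -> monodromy n k e = monodromy n' k e.
Proof. by move=> QQ; elim: k => //= k ->; rewrite QQ. Qed.

Lemma monodromy_det_periodic n n' k :
  (forall i, Q (n + i) = Q (n' + i)) -> monodromy_det n k = monodromy_det n' k.
Proof. by move=> QQ; apply: eq_bigr => i _; rewrite QQ. Qed.

Variable x : int -> state R.
Hypothesis x_update : forall t, x (t + 1) = update Q (x t).

Let X0 n t := x t n 0 0.
Let X1 n t := x t (n - 1) 1 0.

(** The minus component of the update can be solved for [X1 (n + 1)] because [Q n 1 1] is nonzero;
    the plus component at time t - 1 then gives [X0 (n + 1)]. *)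
Let transfer n t :
  X0 (n + 1) t = tm_a (Q n) * X0 n (t - 1) - tm_b (Q n) * X1 n t /\
  X1 (n + 1) t = tm_b (Q n) * X0 n t - tm_d (Q n) * X1 n (t + 1).
Proof.
have eq0 s : X0 (n + 1) (s + 1) = Q n 0 0 * X0 n s + Q n 0 1 * X1 (n + 1) s.
  rewrite /X0 /X1 x_update mxE /= addrK /coin_op mxE !big_ord_recl big_ord0.
  by rewrite addr0; congr (_ + Q n 0 _ * x s n _ 0); apply/val_inj.
have eq1 s : X1 n (s + 1) = Q n 0 1 * X0 n s + Q n 1 1 * X1 (n + 1) s.
  rewrite /X0 /X1 x_update mxE /= subrK addrK /coin_op mxE.
  rewrite !big_ord_recl big_ord0.
  by rewrite addr0 sym; congr (_ + Q n 1 _ * x s n _ 0); apply/val_inj.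
rewrite /tm_a /tm_b /tm_d sym eq1; split; last by field.
by have := eq0 (t - 1); have := eq1 (t - 1); rewrite subrK => -> ->; field.
Qed.

Lemma monodromy_transfer n k t :
  X0 (n + k%:Z) t = act (col0 n k).1 (X0 n) t + act (col1 n k).1 (X1 n) t /\
  X1 (n + k%:Z) t = act (col0 n k).2 (X0 n) t + act (col1 n k).2 (X1 n) t.
Proof.
elim: k t => [|k IH] t; first by rewrite addr0 !act_one !act_nil addr0 add0r.
have [-> ->] : X0 (n + k.+1%:Z) t = X0 (n + k%:Z + 1) t /\
    X1 (n + k.+1%:Z) t = X1 (n + k%:Z + 1) t.
  by rewrite -addrA -PoszD addn1.
have [-> ->] := transfer (n + k%:Z) t.
rewrite !(proj1 (IH _)) !(proj2 (IH _)) /col0 /col1 /= !act_step1 !act_step2.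
by split; ring.
Qed.

(* The right-hand sides come from the adjugate of the monodromy matrix. *)
Lemma monodromy_transfer_inv n k t :
  monodromy_det n k * X0 n t =
    act (col1 n k).2 (X0 (n + k%:Z)) t - act (col1 n k).1 (X1 (n + k%:Z)) t /\
  monodromy_det n k * X1 n t =
    act (col0 n k).1 (X1 (n + k%:Z)) t - act (col0 n k).2 (X0 (n + k%:Z)) t.
Proof.
elim: k t => [|k IH] t.
  by rewrite /monodromy_det big_ord0 !mul1r addr0 !act_one !act_nil !subr0.
have eX0 : X0 (n + k.+1%:Z) = fun s => tm_a (Q (n + k%:Z)) *
    X0 (n + k%:Z) (s + -1) + (- tm_b (Q (n + k%:Z))) * X1 (n + k%:Z) s.
  apply/funext => s; rewrite -addn1 PoszD addrA (proj1 (transfer _ _)).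
  by rewrite (mulNr (tm_b _)).
have eX1 : X1 (n + k.+1%:Z) = fun s => tm_b (Q (n + k%:Z)) *
    X0 (n + k%:Z) s + (- tm_d (Q (n + k%:Z))) * X1 (n + k%:Z) (s + 1).
  apply/funext => s; rewrite -addn1 PoszD addrA (proj2 (transfer _ _)).
  by rewrite (mulNr (tm_d _)).
have [e1 e2] := IH t.
rewrite /monodromy_det big_ord_recr -/(monodromy_det n k) /col0 /col1 /=.
rewrite -/(col0 n k) -/(col1 n k) !act_step1 !act_step2 eX0 eX1 !act_comb.
rewrite !(act_shift _ (X0 (n + k%:Z)) (-1)) !(act_shift _ (X1 (n + k%:Z)) 1).
rewrite !addrK ?subrK tm_detE.
by rewrite !(mulrAC _ (_ - _)) e1 e2; split; ring.
Qed.

(** Cayley-Hamilton as M + det(M) M^-1 = tr(M): M carries site n forward one period, the adjugate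
    carries it back, and the off-diagonal entries cancel. *)
Lemma discriminant_recurrence (p : nat) n t :
  (forall n, Q (n + p%:Z) = Q n) ->
  X0 (n + p%:Z) t + monodromy_det n p * X0 (n - p%:Z) t =
    act (discriminant n p) (X0 n) t /\
  X1 (n + p%:Z) t + monodromy_det n p * X1 (n - p%:Z) t =
    act (discriminant n p) (X1 n) t.
Proof.
move=> Q_per.
have QQ i : Q (n - p%:Z + i) = Q (n + i) by rewrite -Q_per addrAC subrK.
have [e0 e1] := monodromy_transfer n p t.
have := monodromy_transfer_inv (n - p%:Z) p t.
rewrite (monodromy_det_periodic _ QQ) /col0 /col1 !(monodromy_periodic _ _ QQ).
rewrite -/(col0 n p) -/(col1 n p) subrK => -[f0 f1].
by rewrite e0 e1 f0 f1 !act_cat; split; ring.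
Qed.

End Transfer.

(** * Time averages for periodic walks *)

Section PeriodicWalks.
Variable R : realType.
Local Notation C := R[i].

(** One window length N serves all states. This uniformity allows restarting the walk after each
    window and perturbing the coins. *)
Definition time_decay (Q : walk R) (n : int) (s : 'I_2) (e : R) :=
  exists2 N : nat, (0 < N)%N & forall B psi, sq_bounded B psi ->
    \sum_(t < N) normc (iter t (update Q) psi n s 0) ^+ 2 <= e * N%:R * B.

Lemma normc_corr (x : int -> C) N :
  normc (corr N x x) = \sum_(t < N) normc (x t%:Z) ^+ 2.
Proof.
have -> : corr N x x = (\sum_(t < N) normc (x t%:Z) ^+ 2)%:C%C.
  rewrite rmorph_sum; apply: eq_bigr => t _; rewrite normc_sq /=.
  case: (x t%:Z) => a b /=; simpc; congr Complex; ring.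
by rewrite /= expr0n addr0 sqrtr_sqr ger0_norm// sumr_ge0// => t _;
  rewrite sqr_ge0.
Qed.

Lemma periodic_time_decay (Q : walk R) (p : nat) n s (e : R) :
  (0 < p)%N -> (forall n, Q (n + p%:Z) = Q n) -> 0 < e -> time_decay Q n s e.
Proof.
(* The second transfer coordinate at b sits at site b - 1, hence the offset for the minus
   component. *)
move=> p0 Q_per e0; pose b := if s == 0 then n else n + 1.
pose l := discriminant Q b p; pose kap := monodromy_det Q b p.
have Q_perM m i : Q (b + m * p%:Z + i) = Q (b + i).
  have Q_perN k a : Q (a + k%:Z * p%:Z) = Q a.
    elim: k a => [|k IH] a; first by rewrite mul0r addr0.
    by rewrite intS mulrDl mul1r addrA IH Q_per.
  case: m => k; first by rewrite addrAC Q_perN.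
  by rewrite NegzE -(Q_perN k.+1) mulNr addrAC subrK.
have lE m : discriminant Q (b + m * p%:Z) p = l.
  by rewrite /discriminant !(monodromy_periodic _ _ (Q_perM m)).
have kapE m : monodromy_det Q (b + m * p%:Z) p = kap.
  exact: monodromy_det_periodic.
(* 3 / e <= M turns the conclusion of [wave_decay] into the bound e N B, and [N] meets its
   threshold; neither depends on psi. *)
pose M := (Num.bound (3 / e)).+1.
pose N := (Num.bound (4 * lweight l * M%:R ^+ 4)).+1.
have bound (y : R) : 0 <= y -> y <= (Num.bound y).+1%:R.
  move=> y0; apply: ltW; apply: lt_le_trans (archi_boundP y0) _.
  by rewrite ler_nat.
exists N => // B psi psiB; have B0 := sq_bounded_ge0 psiB.
(* The discriminant also reads times outside the window, negative ones included, so the two-sided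
   orbit is needed. *)
pose x t := update_pow Q t psi.
pose c m t := x t (n + m * p%:Z) s 0.
have xB t : sq_bounded B (x t) by exact: sq_bounded_pow.
have bessel t k (f : 'I_k -> int) : injective f ->
    \sum_(i < k) normc (c (f i) t) ^+ 2 <= B.
  move=> f_inj; pose g i := n + f i * p%:Z.
  have g_inj : injective g.
    move=> i j /addrI /mulIf => /(_ _)/f_inj; apply; lia.
  apply: le_trans (sq_bounded_inj (xB t) g_inj).
  apply: ler_sum => i _; rewrite ler_pXn2r ?nnegrE ?normc_ge0 ?vnorm_ge0//.
  exact: normc_le_vnorm.
have rec m t : c (m + 1) t + kap * c (m - 1) t = act l (c m) t.
  have [r0 r1] := discriminant_recurrence (update_powS Q ^~ psi)
    (b + m * p%:Z) t Q_per.
  move: r0 r1; rewrite kapE lE /c /x /b !mulrDl mulNr mul1r.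
  by case: (ord2P s) => -> /=; rewrite ?(addrAC _ 1) ?addrK !addrA.
have M0 : 0 < M%:R :> R by rewrite ltr0n.
have := @wave_decay R c B l kap N bessel rec (discriminant_star Q b p)
  (monodromy_det_norm Q b p) M isT.
rewrite normc_corr {1}/N => /(_ _)/wrap[].
  by apply: bound; rewrite !mulr_ge0 ?lweight_ge0 ?exprn_ge0.
rewrite mulrC -ler_pdivlMr// /c => decay.
have -> : \sum_(t < N) normc (iter t (update Q) psi n s 0) ^+ 2 =
    \sum_(t < N) normc (x t%:Z (n + 0 * p%:Z) s 0) ^+ 2.
  by apply: eq_bigr => t _; rewrite mul0r addr0.
apply: (le_trans decay).
have -> : e * N%:R * B = e * (N%:R * B) by rewrite mulrA.
rewrite ler_pdivrMr// [leRHS]mulrAC -[leLHS]mulrA ler_wpM2r ?mulr_ge0//.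
by rewrite -ler_pdivrMl// mulrC bound// divr_ge0// ltW.
Qed.

End PeriodicWalks.

(** * Long averages, stability under perturbation, density of periodic walks *)

Section GenericDecay.
Variable R : realType.
Local Notation C := R[i].
Implicit Types (Q : walk R) (psi : state R).

(** Cut the M times into blocks of length N: each block restarts from a state with the same bound B,
    and the incomplete last block costs at most e N B. *)
Lemma time_decay_window Q n s (e : R) : 0 <= e -> time_decay Q n s e ->
  exists N : nat, forall B psi, sq_bounded B psi -> forall M : nat,
    \sum_(t < M) normc (iter t (update Q) psi n s 0) ^+ 2 <=
      e * (M + N)%:R * B.
Proof.
move=> e0 [N N0 decay]; exists N => B psi psiB M.
have B0 := sq_bounded_ge0 psiB.
elim/ltn_ind: M psi psiB => M IH psi psiB.
have [MN|NM] := leqP M N.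
  apply: le_trans (_ : _ <= e * N%:R * B) _.
    apply: le_trans (decay _ _ psiB).
    rewrite (big_ord_widen _
      (fun t => normc (iter t (update Q) psi n s 0) ^+ 2) MN).
    rewrite [leRHS](bigID (fun t : 'I_N => t < M)%N) lerDl sumr_ge0// => t _.
    exact: sqr_ge0.
  by rewrite ler_wpM2r// ler_wpM2l// ler_nat leq_addl.
have ME : M = (N + (M - N))%N by rewrite subnKC// ltnW.
move: (M - N)%N ME => m ME; subst M; rewrite big_split_ord /=.
have -> : e * (N + m + N)%:R * B = e * N%:R * B + e * (m + N)%:R * B.
  by rewrite -addnA natrD; ring.
apply: lerD; first exact: decay.
under eq_bigr do rewrite addnC iterD.
apply: IH; first by lia.
by elim: N {N0 decay NM} => //= N; exact: sq_bounded_update.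
Qed.

Lemma time_decay_cvg Q n s psi :
  (forall k : nat, time_decay Q n s k.+1%:R^-1) -> l2 psi ->
  (2 * N + 1)%:R^-1 *
    symsum N (fun t => normc (update_pow Q t psi n s 0) ^+ 2)
  @[N --> \oo] --> (0 : R).
Proof.
move=> decay /l2_sq_bounded[B psiB]; have B0 := sq_bounded_ge0 psiB.
(* [k] makes 2 B / (k + 1) <= e; the factor 2 absorbs the extra [N0] in the window bound once N >=
   N0. *)
apply/cvgrPdist_le => e e0; pose k := Num.bound (2 * B / e).
have [|N0 window] := time_decay_window _ (decay k); first by rewrite invr_ge0.
near=> N; have N0N : (N0 <= N)%N by near: N; exact: nbhs_infty_ge.
rewrite sub0r normrN /symsum.
(* Starting from U^(-N) psi turns the symmetric window into a forward one of length 2 N + 1. *)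
under eq_bigr do rewrite addrC update_powD.
have M0 : 0 < (2 * N + 1)%:R :> R by rewrite ltr0n addn1.
rewrite ger0_norm; last first.
  apply: mulr_ge0; first by rewrite invr_ge0.
  by apply: sumr_ge0 => t _; exact: sqr_ge0.
rewrite mulrC ler_pdivrMr//.
apply: le_trans (window _ _ (@sq_bounded_pow R Q (- N%:Z) B psi psiB) _) _.
have kB : 2 * B <= e * k.+1%:R.
  rewrite [leRHS]mulrC -ler_pdivrMr//; apply: ltW.
  have Be0 : 0 <= 2 * B / e by rewrite divr_ge0 ?mulr_ge0// ltW.
  by apply: lt_le_trans (archi_boundP Be0) _; rewrite ler_nat.
rewrite -mulrA mulrC ler_pdivrMr ?ltr0n// mulrAC.
apply: le_trans (_ : (2 * N + 1)%:R * (2 * B) <= _); last first.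
  by rewrite [leRHS]mulrC ler_wpM2l// ltW.
rewrite mulrA ler_wpM2r// -natrM ler_nat -mul2n; lia.
Unshelve. all: by end_near. Qed.

Lemma vnorm_mulmx_le (A : 'M[C]_2) v : vnorm (A *m v) <= 4 * opnorm A * vnorm v.
Proof.
have entry i : normc ((A *m v) i 0) <= 2 * opnorm A * vnorm v.
  rewrite mxE; apply: le_trans (normc_sum _ _) _.
  apply: le_trans (ler_sum (G := fun=> opnorm A * vnorm v) _ _) _.
    by move=> j _; rewrite normcM ler_pM ?normc_ge0 ?entry_le_opnorm
      ?normc_le_vnorm.
  by rewrite sumr_const card_ord -mulrA mulr_natl.
apply: le_trans (vnorm_le_sum _) _.
by have := entry 0; have := entry 1; lra.
Qed.

Lemma vnorm_shift_op_le psi n :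
  vnorm (shift_op psi n) <= vnorm (psi (n - 1)) + vnorm (psi (n + 1)).
Proof.
apply: le_trans (vnorm_le_sum _) _.
by rewrite !mxE /= lerD ?normc_le_vnorm.
Qed.

(** In one step the new coin preserves the old error, the change of coin adds at most 4 d r, and the
    shift at most doubles the sum: 2 (10^t + 4) <= 10^(t+1). *)
Lemma iter_update_dist (Q Q' : walk R) (d r B : R) psi (t : nat) n :
  walk_dist Q Q' <= d -> 0 <= r -> sq_bounded B psi -> B <= r ^+ 2 ->
  vnorm (iter t (update Q') psi n - iter t (update Q) psi n) <=
    10 ^+ t * (d * r).
Proof.
move=> QQ' r0 psiB Br; have d0 := le_trans (walk_dist_ge0 Q Q') QQ'.
elim: t n => [|t IH] n; first by rewrite subrr vnorm0 !mulr_ge0.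
set u' := iter t (update Q') psi; set u := iter t (update Q) psi.
pose w m := Q' m *m u' m - Q m *m u m.
have wE m : w m = Q' m *m (u' m - u m) - (Q m - Q' m) *m u m.
  by rewrite mulmxBr mulmxBl opprB addrA subrK.
have -> : iter t.+1 (update Q') psi n - iter t.+1 (update Q) psi n =
    shift_op w n.
  rewrite !iterS -/u -/u'; apply/colP => s.
  have shiftE psi' : shift_op psi' n s 0 =
    if s == 0 then psi' (n - 1) 0 0 else psi' (n + 1) 1 0 by rewrite mxE.
  have subE (y z : 'cV[C]_2) i : (y - z) i 0 = y i 0 - z i 0.
    by rewrite mxE [(- z) i 0]mxE.
  by rewrite subE !shiftE; case: ifP => _; rewrite /w subE.
have uB : sq_bounded B u by exact: (@sq_bounded_pow R Q t%:Z B psi psiB).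
have u_le m : vnorm (u m) <= r.
  rewrite -(@ler_pXn2r _ 2) ?nnegrE ?vnorm_ge0//.
  exact: le_trans (sq_bounded_vnorm m uB) Br.
have w_le m : vnorm (w m) <= 10 ^+ t * (d * r) + 4 * (d * r).
  rewrite wE; apply: le_trans (vnormD _ _) _.
  rewrite vnormN vnorm_coin lerD ?IH//.
  apply: le_trans (vnorm_mulmx_le _ _) _.
  rewrite -mulrA ler_wpM2l// ler_pM ?opnorm_ge0 ?vnorm_ge0//.
  exact: le_trans (walk_dist_ub _ _ _) QQ'.
apply: le_trans (vnorm_shift_op_le _ _) _.
apply: le_trans (lerD (w_le _) (w_le _)) _; rewrite exprS -mulrA.
have dr : d * r <= 10 ^+ t * (d * r).
  by rewrite ler_peMl ?mulr_ge0// exprn_ege1// ler1n.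
clear -dr; move: (10 ^+ t * (d * r)) (d * r) dr => X y; lra.
Qed.

Lemma near_time_decay Q n s (e : R) : 0 < e -> time_decay Q n s (e / 4) ->
  \forall Q' \near Q, time_decay Q' n s e.
Proof.
move=> e0 [N N0 decay].
have p0 : 0 < 10 ^+ N :> R by rewrite exprn_gt0.
(* Keeps the error at all times t < N below the square root of (e / 4) B. *)
pose d := Num.sqrt (e / 4) / 10 ^+ N.
have d0 : 0 < d by rewrite divr_gt0// sqrtr_gt0 divr_gt0.
apply/nbhs_ballP; exists d => //= Q' QQ'; exists N => // B psi psiB.
have {}QQ' : walk_dist Q Q' <= d.
  by move: QQ'; rewrite ballEmdist /=; exact: ltW.
have B0 := sq_bounded_ge0 psiB; have r2 := sqr_sqrtr B0.
(* From |u'|^2 <= 2 |u' - u|^2 + 2 |u|^2: each half of e N B pays for one term. *)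
have -> : e * N%:R * B = \sum_(t < N) e / 2 * B + 2 * (e / 4 * N%:R * B).
  by rewrite sumr_const card_ord -mulr_natr; lra.
apply: le_trans (lerD (lexx _) (ler_wpM2l _ (decay _ _ psiB))) => //.
rewrite mulr_sumr -big_split; apply: ler_sum => t _ /=.
set u' := iter t (update Q') psi n; set u := iter t (update Q) psi n.
have dist2 : normc (u' s 0 - u s 0) ^+ 2 <= e / 4 * B.
  have : normc (u' s 0 - u s 0) <= Num.sqrt (e / 4) * Num.sqrt B.
    have := normc_le_vnorm (u' - u) s; rewrite !mxE => /le_trans; apply.
    apply: le_trans (iter_update_dist (r := Num.sqrt B) t n QQ' _ psiB _) _
      => //.
      by rewrite r2.
    rewrite mulrA ler_wpM2r ?sqrtr_ge0// /d mulrA ler_pdivrMr// mulrC.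
    by rewrite ler_wpM2l ?sqrtr_ge0// ler_weXn2l// ?ler1n// ltnW.
  move=> dist; have -> : e / 4 * B = (Num.sqrt (e / 4) * Num.sqrt B) ^+ 2.
    by rewrite exprMn r2 sqr_sqrtr// divr_ge0// ltW.
  by rewrite ler_pXn2r ?nnegrE ?normc_ge0 ?mulr_ge0 ?sqrtr_ge0.
have := ler_normcD (u' s 0 - u s 0) (u s 0); rewrite subrK.
have := normc_ge0 (u' s 0); have := normc_ge0 (u s 0).
have := normc_ge0 (u' s 0 - u s 0); move: dist2.
move: (normc (u' s 0)) (normc (u s 0)) (normc (u' s 0 - u s 0)) => a b c c2.
move=> c0 b0 a0 abc.
have : a ^+ 2 <= (c + b) ^+ 2 by rewrite ler_pXn2r// ?nnegrE// addr_ge0.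
have := sqr_ge0 (c - b); rewrite sqrrB sqrrD; lra.
Qed.

Definition is_periodic Q :=
  exists2 p : nat, (0 < p)%N & forall n, Q (n + p%:Z) = Q n.

(** Repeat one period of coins of [Q] itself: the periodic approximants [P k] need not have coins of
    the form [Theta]. *)
Lemma dense_periodic : dense [set Q | is_periodic Q].
Proof.
move=> O [Q OQ] oO; have /nbhs_ballP[d /= d0 dO] := open_nbhs_nbhs (conj oO OQ).
have [P [P_per PQ]] := coin_limit_periodic Q.
have [K _ /(_ K (leqnn K)) QPK] := PQ (d / 3) (divr_gt0 d0 (ltr0n _ 3)).
have [p p0 PKp] := P_per K.
have PKpN k n : P K (n + k%:Z * p%:Z) = P K n.
  elim: k n => [|k IH] n; first by rewrite mul0r addr0.
  by rewrite intS mulrDl mul1r addrA IH PKp.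
have PKmod n : P K (n %% p%:Z)%Z = P K n.
  rewrite {2}(divz_eq n p%:Z) addrC; case: (n %/ p%:Z)%Z => k.
    by rewrite PKpN.
  by rewrite NegzE -[RHS](PKpN k.+1) mulNr subrK.
pose q n := Q (n %% p%:Z)%Z.
have q_per n : q (n + p%:Z) = q n by rewrite /q modzDr.
have q_lim : limit_periodic q.
  exists (fun=> q); split=> [_|e e0]; first by exists p.
  by near=> k => n; rewrite subrr opnorm0 ltW.
pose Q' := Walk q_lim (fun n => coin_Theta Q _) (fun n => coin_neq0 Q _).
exists Q'; split; last by exists p.
apply: dO; rewrite ballEmdist /=.
apply: le_lt_trans (_ : _ <= d / 3 + d / 3) _; last by lra.
apply: walk_dist_le => n; rewrite -[Q n](subrK (P K n)) -addrA.
apply: le_trans (opnormD _ _) _; rewrite lerD// -opnormN opprB -PKmod.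
exact: QPK.
Unshelve. all: by end_near. Qed.

End GenericDecay.

(** * Passage to generic walks *)

Lemma cvg_symsum (R : realType) (J : nat) (f : int -> nat -> R) :
  (forall j, f j N @[N --> \oo] --> (0 : R)) ->
  symsum J (f ^~ N) @[N --> \oo] --> (0 : R).
Proof.
move=> f0; rewrite /symsum; elim: J.*2.+1 (J%:Z) => [|n IH] a.
  by under eq_fun do rewrite big_ord0; exact: cvg_cst.
under eq_fun do rewrite big_ord_recr.
by have := cvgD (IH a) (f0 (n%:Z - a)); rewrite addr0; apply.
Qed.

Theorem corollary2p3 (R : realType) :
  baire_generic (fun Q : walk R =>
    forall (psi : state R) (J : nat), l2 psi ->
      (fun N : nat =>
        (2 * N + 1)%:R^-1 *
        symsum N (fun n =>
          symsum J (fun j =>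
            normc (inner (phi j) (update_pow Q n psi)) ^+ 2)))
      @ \oo --> (0 : R)).
Proof.
(* [unpickle] enumerates the triples (n, s, k); an index coding no triple imposes no condition. *)
pose O i : set (walk R) := if unpickle i is Some (n, s, k)
  then [set Q | time_decay Q n s (k : nat).+1%:R^-1] else setT.
exists (\bigcap_i interior (O i)); split.
- by exists (fun i => interior (O i)) => // i; exact: open_interior.
- move=> U U0 oU; have [Q [UQ [p p0 Qp]]] := dense_periodic U0 oU.
  exists Q; split=> // i _; rewrite /O.
  case: (unpickle i) => [[[n s] k]|]; last exact: filterT.
  (* A periodic walk satisfies the condition even with a quarter of the constant, so a whole
     neighbourhood satisfies it. *)
  apply: near_time_decay; first by rewrite invr_gt0.
  by apply: periodic_time_decay Qp _; rewrite // divr_gt0// invr_gt0.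
move=> Q QG psi J psi2.
have decay n s k : time_decay Q n s k.+1%:R^-1.
  have := interior_subset (QG (pickle (n, s, k)) I).
  by rewrite /O pickleK.
under eq_fun => N.
  have -> : (2 * N + 1)%:R^-1 * symsum N (fun n => symsum J (fun j =>
      normc (inner (phi j) (update_pow Q n psi)) ^+ 2)) =
    symsum J (fun j => (2 * N + 1)%:R^-1 * symsum N (fun n =>
      normc (inner (phi j) (update_pow Q n psi)) ^+ 2)).
    by rewrite /symsum exchange_big mulr_sumr.
  over.
apply: cvg_symsum => j; rewrite /phi.
under eq_fun do under [symsum _ _]eq_bigr do rewrite inner_delta.
exact: time_decay_cvg.
Qed.
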